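(* Let $A \in \mathbb{R}^{m \times n}$, $B \in \mathbb{R}^{m \times p}$, $C \in \mathbb{R}^{s \times n}$, $D \in \mathbb{R}^{s \times p}$ and $M=\begin{pmatrix} A & B \\ C & D \end{pmatrix}$. (i) Suppose that $R(B)\subseteq R(A)$ and $R(C^T)\subseteq R(A^T)$, and let $H=pppt(M,A)_{\dagger}$. Then for all $x^1\in\mathbb{R}^n$, $x^2\in\mathbb{R}^p$, $y^1\in\mathbb{R}^m$, $y^2\in\mathbb{R}^s$, $$M\begin{pmatrix} x^{1}\\ x^{2}\end{pmatrix}=\begin{pmatrix} AA^\dagger y^{1}\\ y^{2}\end{pmatrix}\quad\text{if and only if}\quad H\begin{pmatrix} y^{1}\\ x^{2}\end{pmatrix}=\begin{pmatrix} A^\dagger A x^{1}\\ y^{2}\end{pmatrix}.$$ (ii) Suppose that $R(C)\subseteq R(D)$ and $R(B^T)\subseteq R(D^T)$, and let $J=cpppt(M,D)_{\dagger}$. Then for all $x^1\in\mathbb{R}^n$, $x^2\in\mathbb{R}^p$, $y^1\in\mathbb{R}^m$, $y^2\in\mathbb{R}^s$, $$M\begin{pmatrix} x^{1}\\ x^{2}\end{pmatrix}=\begin{pmatrix} y^{1}\\ DD^\dagger y^{2}\end{pmatrix}\quad\text{if and only if}\quad J\begin{pmatrix} x^{1}\\ y^{2}\end{pmatrix}=\begin{pmatrix} y^{1}\\ D^\dagger D x^{2}\end{pmatrix}.$$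
   Context: All matrices are real. $R(X)$ denotes the range (column space) of a matrix $X$ and $X^T$ its transpose. For $X\in\mathbb{R}^{m\times n}$, the Moore-Penrose inverse $X^\dagger\in\mathbb{R}^{n\times m}$ is the unique matrix $Y$ satisfying $X=XYX$, $Y=YXY$, $(XY)^T=XY$ and $(YX)^T=YX$. For a block matrix $M=\begin{pmatrix} A & B \\ C & D \end{pmatrix}$, the pseudo principal pivot transform of $M$ relative to $A$ is $$pppt(M,A)_{\dagger}=\begin{pmatrix} A^\dagger & -A^\dagger B\\ CA^\dagger & F\end{pmatrix},\qquad F=D-CA^\dagger B,$$ and the complementary pseudo principal pivot transform of $M$ relative to $D$ is $$cpppt(M,D)_{\dagger}=\begin{pmatrix} G & BD^\dagger\\ -D^\dagger C & D^\dagger\end{pmatrix},\qquad G=A-BD^\dagger C.$$ *)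

(* Defs.v *)
From mathcomp Require Import all_boot all_order all_algebra.
From mathcomp Require Import boolp classical_sets reals.

Set Implicit Arguments.
Unset Strict Implicit.
Unset Printing Implicit Defensive.

Import Order.TTheory GRing.Theory Num.Theory.
Local Open Scope ring_scope.
Local Open Scope classical_set_scope.

Definition colspace (R : realType) m n (X : 'M[R]_(m, n)) : set 'cV[R]_m :=
  [set X *m v | v in [set: 'cV[R]_n]].

Definition is_mpinv (R : realType) m n (X : 'M[R]_(m, n)) (Y : 'M[R]_(n, m)) :
  Prop :=
  [/\ X = X *m Y *m X, Y = Y *m X *m Y,
      (X *m Y)^T = X *m Y & (Y *m X)^T = Y *m X].

(* The Moore-Penrose inverse.  The default value 0 is never used: see [mpinvP]
   and [mpinv_unique]. *)
Definition mpinv (R : realType) m n (X : 'M[R]_(m, n)) : 'M[R]_(n, m) :=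
  xget 0 [set Y | is_mpinv X Y].

Lemma is_mpinv_unique (R : realType) m n (X : 'M[R]_(m, n)) Y Z :
  is_mpinv X Y -> is_mpinv X Z -> Y = Z.
Proof.
move=> [Y1 Y2 Y3 Y4] [Z1 Z2 Z3 Z4].
have XYZ : X *m Y = X *m Z.
  rewrite -Y3 [in LHS]Z1 -[X *m Z *m X *m Y]mulmxA trmx_mul Y3 Z3.
  by rewrite mulmxA -Y1.
have YXZ : Y *m X = Z *m X.
  rewrite -Y4 [in LHS]Z1 !mulmxA -[Y *m X *m Z *m X]mulmxA trmx_mul Y4 Z4.
  by rewrite -mulmxA (mulmxA X) -Y1.
by rewrite Y2 YXZ -mulmxA XYZ mulmxA -Z2.
Qed.

Lemma gram_unitmx (R : realType) m n (X : 'M[R]_(m, n)) :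
  row_free X -> X *m X^T \in unitmx.
Proof.
move=> Xfree; rewrite -row_free_unit; apply: inj_row_free => v vXX.
apply: (row_free_inj Xfree); rewrite mul0mx.
have /matrixP/(_ 0 0) : (v *m X) *m (v *m X)^T = 0.
  by rewrite trmx_mul mulmxA -(mulmxA v) vXX mul0mx.
rewrite !mxE => /eqP; rewrite psumr_eq0 => [/allP sq0|j _]; last first.
  by rewrite !mxE -expr2 sqr_ge0.
apply/rowP => j; have := sq0 j (mem_index_enum j).
by rewrite [_^T _ _]mxE /= mulf_eq0 orbb [RHS]mxE => /eqP.
Qed.

Lemma is_mpinv_exists (R : realType) m n (X : 'M[R]_(m, n)) :
  exists Y, is_mpinv X Y.
Proof.
move: (col_base_full X) (row_base_free X) (mulmx_base X).
move: (\rank X) (col_base X) (row_base X) => r C S Cfull Sfree /esym XE.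
have Su : S *m S^T \in unitmx by exact: gram_unitmx.
have Cu : C^T *m C \in unitmx.
  rewrite -[X in _ *m X]trmxK; apply: gram_unitmx.
  by rewrite /row_free mxrank_tr.
pose S' := S^T *m invmx (S *m S^T); pose C' := invmx (C^T *m C) *m C^T.
have SS' : S *m S' = 1%:M by rewrite mulmxA mulmxV.
have C'C : C' *m C = 1%:M by rewrite -mulmxA mulVmx.
have XY : X *m (S' *m C') = C *m C'.
  by rewrite XE -mulmxA [S *m _]mulmxA SS' mul1mx.
have YX : S' *m C' *m X = S' *m S.
  by rewrite XE -mulmxA (mulmxA C') C'C mul1mx.
have [trXY trYX] : (C *m C')^T = C *m C' /\ (S' *m S)^T = S' *m S.
  by split; rewrite !trmx_mul trmxK trmx_inv trmx_mul trmxK mulmxA.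
exists (S' *m C'); split; rewrite ?XY ?YX //.
- by rewrite XE mulmxA -(mulmxA C) C'C mulmx1.
- by rewrite -[RHS]mulmxA [S *m (S' *m C')]mulmxA SS' mul1mx.
Qed.

Lemma mpinvP (R : realType) m n (X : 'M[R]_(m, n)) : is_mpinv X (mpinv X).
Proof.
by have [Y YP] := is_mpinv_exists X; exact: (xgetPex 0 (ex_intro _ Y YP)).
Qed.

Lemma mpinv_unique (R : realType) m n (X : 'M[R]_(m, n)) Y :
  is_mpinv X Y -> Y = mpinv X.
Proof. by move=> YP; exact: is_mpinv_unique YP (mpinvP X). Qed.

(* The pivot block A (resp. D) is the upper left (resp. lower right) block of
   M in the splitting given by the type of M. *)
Definition pppt (R : realType) m s n p (M : 'M[R]_(m + s, n + p)) :
  'M[R]_(n + s, m + p) :=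
  let A := ulsubmx M in let B := ursubmx M in
  let C := dlsubmx M in let D := drsubmx M in
  block_mx (mpinv A)        (- (mpinv A *m B))
           (C *m mpinv A)   (D - C *m mpinv A *m B).

Definition cpppt (R : realType) m s n p (M : 'M[R]_(m + s, n + p)) :
  'M[R]_(m + p, n + s) :=
  let A := ulsubmx M in let B := ursubmx M in
  let C := dlsubmx M in let D := drsubmx M in
  block_mx (A - B *m mpinv D *m C)   (B *m mpinv D)
           (- (mpinv D *m C))        (mpinv D).

(* Main.v *)
Require Import Defs.
From mathcomp Require Import all_boot all_order all_algebra.
From mathcomp Require Import boolp classical_sets reals.

(** The pivot exchanges the roles of the first unknown and the first right-hand
side, as it does for an invertible pivot block, but only up to the projections
[A A^+] and [A^+ A].  Two facts make this work.

The range hypotheses say that these projections are invisible to the other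
blocks: [A A^+ B = B] and [C A^+ A = C] ([ginv_absorbl], [ginv_absorbr]).

Hence the first block row [A x1 + B x2 = A A^+ y1] lies in the range of [A],
where [A^+] is injective with inverse [A]; applying [A^+] turns it into
[A^+ A x1 = A^+ y1 - A^+ B x2], and applying [A] turns it back.  Given that
equation, [C x1 = C A^+ A x1 = C A^+ y1 - C A^+ B x2], so that the second block
rows of the two systems coincide ([pivot_systemP]).

Both parts are this one equivalence: the second is the first for the matrix
with blocks [D, C, B, A], in which [D] is the pivot. *)

Local Open Scope ring_scope.
Local Open Scope classical_set_scope.

Import GRing.Theory.

(** On the range of [A], the matrix [A X] acts as the identity, and every column
of [B] lies in that range. *)
Lemma ginv_absorbl (R : realType) (m n p : nat) (A : 'M[R]_(m, n))
    (X : 'M[R]_(n, m)) (B : 'M[R]_(m, p)) :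
  A = A *m X *m A -> colspace B `<=` colspace A -> A *m X *m B = B.
Proof.
move=> AXA sBA; apply/trmx_inj/row_matrixP => j; rewrite -!tr_col; congr trmx.
have [v _ vE] : colspace A (col j B).
  by apply: sBA; exists (delta_mx j 0) => //; rewrite -colE.
by rewrite !colE -mulmxA -colE -vE mulmxA -AXA.
Qed.

Lemma ginv_absorbr (R : realType) (m n s : nat) (A : 'M[R]_(m, n))
    (X : 'M[R]_(n, m)) (C : 'M[R]_(s, n)) :
  A = A *m X *m A -> colspace C^T `<=` colspace A^T -> C *m X *m A = C.
Proof.
move=> AXA sCA; apply: trmx_inj; rewrite !trmx_mul mulmxA.
by apply: ginv_absorbl sCA; rewrite -mulmxA -!trmx_mul -AXA.
Qed.

(** Both sides of the first block equation lie in the range of [A], between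
which and the range of [X] the matrices [X] and [A] are mutually inverse; the
first equations are therefore equivalent, and each determines [C x1] because
[C = C X A]. *)
Lemma pivot_systemP (R : pzRingType) (m n p s k : nat)
    (A : 'M[R]_(m, n)) (B : 'M[R]_(m, p)) (C : 'M[R]_(s, n)) (D : 'M[R]_(s, p))
    (X : 'M[R]_(n, m)) (x1 : 'M[R]_(n, k)) (x2 : 'M[R]_(p, k))
    (y1 : 'M[R]_(m, k)) (y2 : 'M[R]_(s, k)) :
  X = X *m A *m X -> A *m X *m B = B -> A = A *m X *m A -> C *m X *m A = C ->
  A *m x1 + B *m x2 = A *m X *m y1 /\ C *m x1 + D *m x2 = y2 <->
  X *m y1 - X *m B *m x2 = X *m A *m x1 /\
    C *m X *m y1 + (D - C *m X *m B) *m x2 = y2.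
Proof.
move=> XAX AXB AXA CXA.
have row1P : A *m x1 + B *m x2 = A *m X *m y1 <->
    X *m y1 - X *m B *m x2 = X *m A *m x1.
  split=> [e|e].
    have := congr1 (mulmx X) e; rewrite mulmxDr !mulmxA -XAX => <-.
    by rewrite addrK.
  have := congr1 (mulmx A) e; rewrite mulmxBr !mulmxA -AXA AXB => <-.
  by rewrite subrK.
have row2E : X *m y1 - X *m B *m x2 = X *m A *m x1 ->
    C *m X *m y1 + (D - C *m X *m B) *m x2 = C *m x1 + D *m x2.
  move=> /(congr1 (mulmx C)); rewrite mulmxBr !mulmxA CXA => <-.
  by rewrite mulmxBl addrA addrAC.
split=> -[e1 e2].
  by move/row1P: e1 => e1; rewrite row2E.
by rewrite row2E // in e2; split=> //; apply/row1P.
Qed.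

Theorem lemma1p1 (R : realType) (m n p s : nat)
    (A : 'M[R]_(m, n)) (B : 'M[R]_(m, p))
    (C : 'M[R]_(s, n)) (D : 'M[R]_(s, p)) :
  let M : 'M[R]_(m + s, n + p) := block_mx A B C D in
  (colspace B `<=` colspace A ->
   colspace C^T `<=` colspace A^T ->
   let H := pppt M in
   forall (x1 : 'cV[R]_n) (x2 : 'cV[R]_p) (y1 : 'cV[R]_m) (y2 : 'cV[R]_s),
     M *m col_mx x1 x2 = col_mx (A *m mpinv A *m y1) y2 <->
     H *m col_mx y1 x2 = col_mx (mpinv A *m A *m x1) y2)
  /\
  (colspace C `<=` colspace D ->
   colspace B^T `<=` colspace D^T ->
   let J := cpppt M in
   forall (x1 : 'cV[R]_n) (x2 : 'cV[R]_p) (y1 : 'cV[R]_m) (y2 : 'cV[R]_s),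
     M *m col_mx x1 x2 = col_mx y1 (D *m mpinv D *m y2) <->
     J *m col_mx x1 y2 = col_mx y1 (mpinv D *m D *m x2)).
Proof.
have col_mxP q r k (u u' : 'M[R]_(q, k)) (v v' : 'M[R]_(r, k)) :
    col_mx u v = col_mx u' v' <-> u = u' /\ v = v'.
  by split=> [/eq_col_mx|[-> ->]].
move=> M; split=> [sBA sCA|sCD sBD] /= x1 x2 y1 y2;
  rewrite /M /pppt /cpppt block_mxKul block_mxKur block_mxKdl block_mxKdr;
  rewrite !mul_block_col !col_mxP !mulNmx.
  have [AXA XAX _ _] := mpinvP A.
  by apply: pivot_systemP => //; [apply: ginv_absorbl|apply: ginv_absorbr].
have [DQD QDQ _ _] := mpinvP D.
(* Exchanging the two block rows and the two block columns makes D the pivot. *)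
have DQC : D *m mpinv D *m C = C by apply: ginv_absorbl.
have BQD : B *m mpinv D *m D = B by apply: ginv_absorbr.
have := @pivot_systemP _ _ _ _ _ _ D C B A (mpinv D) x2 x1 y2 y1 QDQ DQC DQD BQD.
rewrite [D *m x2 + _]addrC [B *m x2 + _]addrC [mpinv D *m y2 - _]addrC.
rewrite [B *m _ *m y2 + _]addrC => swappedP.
by split=> /and_comm /swappedP /and_comm.
Qed.
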